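(* For every $n\ge 1$ there exists a finite constant $\mathcal{C}_n$ (depending only on $n$) such that for all Lebesgue measurable sets $E_1,\dots,E_n\subset\mathfrak{M}^{n\times n}(\mathbb{R})$ of finite measure, $$\prod_{j=1}^{n}|E_j|^{\frac{1}{n^{2}}}\le \mathcal{C}_n\sup_{A_1\in E_1,\dots,A_n\in E_n}\big|\det(A_1+\dots+A_n)\big|.$$
   Context: $\mathfrak{M}^{n\times n}(\mathbb{R})$ is the space of real $n\times n$ matrices, identified with $\mathbb{R}^{n^2}$ via its entries; $|E|$ denotes the Lebesgue measure on $\mathbb{R}^{n^2}$, and $\det$ is the ordinary determinant of a square matrix. The supremum is the pointwise supremum over all choices $A_j\in E_j$. *)

(* Defs.v *)
From HB Require Import structures.
From mathcomp Require Import all_boot all_order all_algebra.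
From mathcomp Require Import all_classical all_reals all_analysis.
Set Implicit Arguments. Unset Strict Implicit. Unset Printing Implicit Defensive.
Import Order.TTheory GRing.Theory Num.Theory.
Local Open Scope classical_set_scope.
Local Open Scope ring_scope.

Definition mx_box (R : realType) (n : nat) (a b : 'M[R]_n) : set 'M[R]_n :=
  [set A | forall i j, a i j <= A i j /\ A i j < b i j].

Definition mx_box_vol (R : realType) (n : nat) (a b : 'M[R]_n) : R :=
  \prod_(i < n) \prod_(j < n) Num.max 0 (b i j - a i j).

Definition mx_lebesgue_outer (R : realType) (n : nat) (E : set 'M[R]_n)
  : \bar R :=
  ereal_inf [set s : \bar R | exists a b : nat -> 'M[R]_n,
     E `<=` \bigcup_k mx_box (a k) (b k) /\
     s = (\sum_(0 <= k <oo) ((mx_box_vol (a k) (b k))%:E))%E].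

Definition mx_lebesgue_measurable (R : realType) (n : nat) (E : set 'M[R]_n)
  : Prop :=
  forall B : set 'M[R]_n,
    mx_lebesgue_outer B =
    (mx_lebesgue_outer (B `&` E) + mx_lebesgue_outer (B `&` ~` E))%E.

(* sup over A_j in E_j of |det(A_1 + ... + A_n)|, as an extended real;
   the value 0 is included so that the sup of these nonnegative quantities
   over an empty family is 0 (standard convention). *)
Definition sup_det_sum (R : realType) (n : nat) (E : 'I_n -> set 'M[R]_n)
  : \bar R :=
  ereal_sup (0%E |` [set (`|\det (\sum_(j < n) A j)|)%:E |
                     A in [set A : 'I_n -> 'M[R]_n | forall j, E j (A j)]]).

(* Main.v *)
(** Taking alternating sums of [det (A_1 + ... + A_n)] over the choices of [A_j]
    among two points of [E_j] bounds the polarized determinant [D] on the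
    differences: [|D(V_1, ..., V_n)| <= 2^n S] for [V_j] in [E_j - E_j], where [S] is
    the supremum.  Order the matrix entries lexicographically.  Slicing [E_j] one
    entry at a time gives, for each entry [x], a difference in [E_j - E_j] whose
    entries before [x] vanish and whose entry [x] has size [l_j x], with
    [|E_j| <= prod_x l_j x] up to constants.  If the leading entries [x_1, ..., x_n]
    occupy each row and each column once, a single term of [D] survives, so
    [prod_j l_j x_j <= 2^n S].  The [n^2] cyclic placements [x_j = (j+s, j+t)] cover
    every entry of every [V_j] exactly once, and multiplying over them yields
    [prod_j |E_j| <= C S^(n^2)].

    The slicing is done on the cells of a fine grid meeting a bounded part of [E_j].
    This replaces Fubini's theorem, and the resulting error tends to 0 with the mesh. *)

Require Import Defs.
From HB Require Import structures.
From mathcomp Require Import all_boot all_order all_algebra.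
From mathcomp Require Import perm.
Set Implicit Arguments. Unset Strict Implicit. Unset Printing Implicit Defensive.
Import Order.TTheory GRing.Theory Num.Theory.
Local Open Scope ring_scope.

(** * The polarized determinant and its alternating-sum formula *)

(** This is the coefficient of [t_1 ... t_n] in [det (t_1 V_1 + ... + t_n V_n)]: row [i] is taken
    from [V (f i)], and injectivity of [f] makes every matrix serve exactly once. *)
Definition polar_det (R : comNzRingType) n (V : 'I_n -> 'M[R]_n) : R :=
  \sum_(f : {ffun 'I_n -> 'I_n} | injectiveb f)
    \sum_(s : 'S_n) (-1) ^+ s * \prod_i V (f i) i (s i).

(** For fixed [f] and [s], the signed sum over [e] factors over [j]. An injective [f] has one row
    per factor, which gives an entry of [A j - A' j]; any other [f] contributes zero. *)
Lemma polar_det_altsum (R : comNzRingType) n (A A' : 'I_n -> 'M[R]_n) :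
  polar_det (fun j => A j - A' j) =
  \sum_(e : {ffun 'I_n -> bool})
    (\prod_j (-1) ^+ (~~ e j)) * \det (\sum_j if e j then A j else A' j).
Proof.
pose W j (b : bool) := if b then A j else A' j.
pose T (f : {ffun 'I_n -> 'I_n}) (s : 'S_n) :=
  \prod_j \sum_b (-1) ^+ (~~ b) * \prod_(i | f i == j) W j b i (s i).
have TE (f : {ffun 'I_n -> 'I_n}) (s : 'S_n) : \sum_(e : {ffun 'I_n -> bool})
    (\prod_j (-1) ^+ (~~ e j)) * \prod_i W (f i) (e (f i)) i (s i) = T f s.
  rewrite /T bigA_distr_bigA; apply: eq_bigr => e _.
  rewrite big_split /=; congr (_ * _).
  rewrite (partition_big f predT) //=; apply: eq_bigr => j _.
  by apply: eq_bigr => i /eqP ->.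
transitivity (\sum_(f : {ffun 'I_n -> 'I_n}) \sum_(s : 'S_n) (-1) ^+ s * T f s).
  rewrite [RHS](bigID (fun f : {ffun _} => injectiveb f)) /= [X in _ + X]big1 ?addr0.
    apply: eq_bigr => f /injectiveP finj; apply: eq_bigr => s _; congr (_ * _).
    rewrite /T [RHS](reindex_inj finj); apply: eq_bigr => i _.
    rewrite big_bool /= expr0 mul1r expr1 mulN1r.
    rewrite !(big_pred1 i) ?mxE // => k; exact: inj_eq.
  move=> f fninj; apply: big1 => s _.
  (* A self-map of a finite set that is not injective misses some [j]; both products over its empty
     fibre are 1, so the factor at [j] is [1 - 1]. *)
  have [j jf] : exists j, j \notin codom f.
    apply/existsP; apply: contraR fninj; rewrite negb_exists => /forallP fs.
    have /image_injP finj : #|image f 'I_n| == #|'I_n|.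
      by apply/eqP/eq_card => j; have := fs j; rewrite negbK => ->.
    by apply/injectiveP => i k; apply: finj.
  have fj i : (f i == j) = false by apply: contraNF jf => /eqP <-; apply: codom_f.
  rewrite /T (bigD1 j) //= big_bool /= !(eq_bigl _ _ fj) !big_pred0_eq.
  by rewrite expr0 expr1 !mulr1 subrr mul0r mulr0.
have detE (e : {ffun 'I_n -> bool}) : \det (\sum_j W j (e j)) =
    \sum_(s : 'S_n) \sum_(f : {ffun 'I_n -> 'I_n})
      (-1) ^+ s * \prod_i W (f i) (e (f i)) i (s i).
  rewrite /determinant; apply: eq_bigr => s _; rewrite -big_distrr /=; congr (_ * _).
  rewrite -(bigA_distr_bigA (fun i j => W j (e j) i (s i))).
  by apply: eq_bigr => i _; rewrite summxE.
under [RHS]eq_bigr => e _ do rewrite detE exchange_big big_distrr /=.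
rewrite [RHS]exchange_big /=; apply: eq_bigr => f _.
under [RHS]eq_bigr => e _ do rewrite big_distrr /=.
rewrite [RHS]exchange_big /=; apply: eq_bigr => s _.
by rewrite -TE big_distrr /=; apply: eq_bigr => e _; rewrite mulrCA.
Qed.

(** * Lexicographic order on entries and the surviving term *)

(** Row-major rank: it encodes the lexicographic order by a number that is additive in row and
    column, so it can be summed over a placement. *)
Definition mx_weight n (i j : 'I_n) : nat := (i * n + j)%N.

Lemma mx_weight_inj n (i j k l : 'I_n) :
  mx_weight i j = mx_weight k l -> i = k /\ j = l.
Proof.
rewrite /mx_weight => e; have := ltn_ord j; have := ltn_ord l => ln jn.
have n0 : (0 < n)%N by apply: leq_trans ln.
split; apply: val_inj => /=.
  by have /(congr1 (divn^~ n)) := e; rewrite !divnMDl // !divn_small // !addn0.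
by have /(congr1 (modn^~ n)) := e; rewrite !modnMDl !modn_small.
Qed.

(* The sum of [mx_weight] over a placement meeting each row and each column once does
   not depend on the placement, so a nonzero term of the expansion must use the leading
   entry of every [V j]. *)
Lemma normr_polar_det_triangular (R : realDomainType) n
    (V : 'I_n.+1 -> 'M[R]_n.+1) (s t : 'I_n.+1) :
  (forall j a b : 'I_n.+1, (mx_weight a b < mx_weight (j + s)%R (j + t)%R)%N -> V j a b = 0) ->
  `|polar_det V| = \prod_j `|V j (j + s) (j + t)|.
Proof.
move=> V0.
(* Index arithmetic is cyclic. [f0] and [s0] describe the one term that uses the leading entry
   [(j + s, j + t)] of every [V j]. *)
pose f0 := [ffun i : 'I_n.+1 => i - s].
have f0inj : injective f0 by move=> i i'; rewrite !ffunE => /addIr.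
pose s0 : 'S_n.+1 := perm (addIr (t - s)).
have sumE (u : 'I_n.+1 -> 'I_n.+1) :
    injective u -> (\sum_i u i = \sum_(i < n.+1) i)%N.
  by move=> uinj; rewrite [RHS](reindex_inj uinj).
have key (f : {ffun 'I_n.+1 -> 'I_n.+1}) (q : 'S_n.+1) : injective f ->
    \prod_i V (f i) i (q i) != 0 -> forall i, i = f i + s /\ q i = f i + t.
  move=> finj /prodf_neq0 nz.
  have wle i : (mx_weight (f i + s)%R (f i + t)%R <= mx_weight i (q i))%N.
    rewrite leqNgt; apply/negP => /V0 Vi0; have := nz i isT.
    by rewrite Vi0 eqxx.
  have fs u : injective (fun i => f i + u) by move=> i i' /addIr /finj.
  have swE : (\sum_i mx_weight (f i + s)%R (f i + t)%R = \sum_i mx_weight i (q i))%N.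
    rewrite /mx_weight !big_split /= -!big_distrl /=.
    by rewrite (sumE _ (fs s)) (sumE _ (fs t)) !sumE //; apply: perm_inj.
  have /eqP := swE.
  (* Termwise inequalities between sums that are equal are all equalities. *)
  have [_ ->] := @leqif_sum _ predT _ _ _ (fun i _ => conj (wle i) erefl).
  by move=> /forallP we i; have /eqP/mx_weight_inj[-> ->] := we i.
rewrite /polar_det (bigD1 f0) /=; last by apply/injectiveP.
rewrite [X in _ + X]big1 ?addr0; last first.
    move=> f /andP[/injectiveP finj ff0]; apply: big1 => q _.
  have [->|/(key _ _ finj) h] := eqVneq (\prod_i V (f i) i (q i)) 0.
    by rewrite mulr0.
  case/eqP: ff0; apply/ffunP => i.
  by rewrite ffunE {2}(proj1 (h i)) addrK.
rewrite (bigD1 s0) //= [X in _ + X]big1 ?addr0; last first.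
  move=> q qs0.
  have [->|/(key _ _ f0inj) h] := eqVneq (\prod_i V (f0 i) i (q i)) 0.
    by rewrite mulr0.
  case/eqP: qs0; apply/permP => i.
  by rewrite permE (proj2 (h i)) ffunE addrA addrAC.
rewrite normrM normrX normrN1 expr1n mul1r normr_prod.
rewrite [RHS](reindex_inj f0inj); apply: eq_bigr => i _.
by rewrite !ffunE permE subrK addrA addrAC.
Qed.

(** * Stability of the polarized determinant under perturbation *)

(** Telescoping: factors are exchanged one at a time, and [1 <= K] lets [K ^+ n] bound the product
    of the others. *)
Lemma dist_prod_le (R : realDomainType) n (a b : 'I_n -> R) (K e : R) :
  1 <= K -> (forall i, `|a i| <= K) -> (forall i, `|b i| <= K) ->
  (forall i, `|a i - b i| <= e) ->
  `|\prod_i a i - \prod_i b i| <= n%:R * K ^+ n * e.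
Proof.
move=> K1 aK bK abe.
have K0 : 0 <= K by apply: le_trans K1.
elim: n a b aK bK abe => [|n IH] a b aK bK abe.
  by rewrite !big_ord0 subrr normr0 !mul0r.
have e0 : 0 <= e by apply: le_trans (abe ord0).
rewrite !big_ord_recl.
have -> : forall x y z w : R, x * y - z * w = (x - z) * y + z * (y - w).
  by move=> x y z w; rewrite mulrBl mulrBr addrA subrK.
apply: (le_trans (ler_normD _ _)); rewrite !normrM.
have := IH (a \o lift ord0) (b \o lift ord0) (fun i => aK _) (fun i => bK _)
  (fun i => abe _).
move=> hd.
have pK : `|\prod_(i < n) a (lift ord0 i)| <= K ^+ n.+1.
  rewrite normr_prod exprS.
  apply: (@le_trans _ _ (K ^+ n)); last by apply: ler_peMl => //; apply: exprn_ge0.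
  rewrite -[X in _ <= K ^+ X]card_ord -prodr_const; apply: ler_prod => i _.
  by rewrite normr_ge0 aK.
rewrite -natr1 mulrDl mul1r mulrDl addrC; apply: lerD.
  by rewrite exprS (mulrCA n%:R) -(mulrA K); apply: ler_pM.
by rewrite [leRHS]mulrC; apply: ler_pM.
Qed.

Lemma dist_polar_det_le (R : realDomainType) n (U V : 'I_n -> 'M[R]_n) (K e : R) :
  1 <= K -> (forall j a b, `|U j a b| <= K) -> (forall j a b, `|V j a b| <= K) ->
  (forall j a b, `|U j a b - V j a b| <= e) -> 0 <= e ->
  `|polar_det U - polar_det V| <=
    #|{ffun 'I_n -> 'I_n}|%:R * #|'S_n|%:R * (n%:R * K ^+ n * e).
Proof.
move=> K1 UK VK UV e0; rewrite /polar_det -sumrB -mulrA mulr_natl -sumr_const.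
have L0 : 0 <= n%:R * K ^+ n * e.
  by rewrite !mulr_ge0 // exprn_ge0 // (le_trans _ K1).
apply: (le_trans (ler_norm_sum _ _ _)).
rewrite [X in X <= _]big_mkcond /=; apply: ler_sum => f _.
case: ifP => _; last by rewrite mulr_ge0.
rewrite mulr_natl -sumr_const -sumrB; apply: (le_trans (ler_norm_sum _ _ _)).
rewrite big_mkcond [leRHS]big_mkcond /=; apply: ler_sum => s _.
rewrite -mulrBr normrM normrX normrN1 expr1n mul1r.
by apply: dist_prod_le.
Qed.

(* The induction step keeps a largest slice of [F] along the first
   coordinate [x], which has at least [#|F| / (k x).+1] elements. *)
Lemma slicing (X : finType) m (w : X -> nat) (s : seq X) (F : {set {ffun X -> 'I_m}}) :
  sorted ltn (map w s) -> F != set0 ->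
  (forall z z', z \in F -> z' \in F -> {in s, z =1 z'} -> z = z') ->
  exists k : X -> nat, (#|F| <= \prod_(x <- s) (k x).+1)%N /\
    forall x, x \in s -> exists p q, [/\ p \in F, q \in F,
      p x = (q x + k x)%N :> nat &
      forall y, y \in s -> (w y < w x)%N -> p y = q y].
Proof.
elim: s F => [|x s IH] F.
  move=> _ _ inj; exists (fun=> 0%N); split => //.
  rewrite big_nil; apply/card_le1_eqP => z z' zF z'F; exact: inj.
move=> /= ws /set0Pn[z0 z0F] inj.
have minx y : y \in s -> (w x < w y)%N.
  have /allP h := order_path_min ltn_trans ws.
  by move=> ys; apply: h; apply: map_f.
have xs : x \notin s by apply/negP => /minx; rewrite ltnn.
pose Fv v := [set z in F | z x == v].
pose v := [arg max_(v > z0 x) #|Fv v|].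
have vmax u : (#|Fv u| <= #|Fv v|)%N.
  by rewrite /v; case: arg_maxnP => // i _; apply.
have Fv0 : Fv v != set0.
  rewrite -card_gt0; apply: leq_trans (vmax (z0 x)); apply/card_gt0P.
  by exists z0; rewrite inE z0F /=.
have [z z'|k [kF kpq]] := IH (Fv v) (path_sorted ws) Fv0.
  rewrite !inE => /andP[zF /eqP zx] /andP[z'F /eqP z'x] e; apply: inj => // y.
  by rewrite inE => /predU1P[->|/e //]; rewrite zx z'x.
(* The extremes are taken over all of [F], not over the largest slice: every value at [x] lies
   between [q x] and [p x], so there are at most [(p x - q x).+1] slices. *)
pose p := [arg max_(p > z0 in F) (p x : nat)].
pose q := [arg min_(q < z0 in F) (q x : nat)].
have [pF pmax] : p \in F /\ forall z, z \in F -> (z x <= p x)%N.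
  by rewrite /p; case: arg_maxnP => // i iF h; split.
have [qF qmin] : q \in F /\ forall z, z \in F -> (q x <= z x)%N.
  by rewrite /q; case: arg_minnP => // i iF h; split.
have card_im : (#|[set (z : {ffun _ -> _}) x | z in F]| <= (p x - q x).+1)%N.
  rewrite cardE -(size_map val) -[X in (_ <= X)%N](size_iota (q x)).
  apply: uniq_leq_size; first by rewrite map_inj_uniq ?enum_uniq //; apply: val_inj.
  move=> _ /mapP[u + ->]; rewrite mem_enum => /imsetP[z zF ->].
  rewrite mem_iota qmin //= addnS ltnS subnKC ?pmax //; exact: qmin.
exists (fun y => if y == x then (p x - q x)%N else k y); split.
  rewrite big_cons eqxx [X in (_ <= _ * X)%N](eq_big_seq (fun y => (k y).+1)); last first.
    by move=> y ys; case: eqP => // yx; rewrite -yx ys in xs.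
  rewrite -sum1_card (partition_big (fun z : {ffun _ -> _} => z x)
    (fun u => u \in [set (z : {ffun _ -> _}) x | z in F])) /=; last first.
    by move=> z zF; apply: imset_f.
  apply: (@leq_trans (\sum_(u in [set (z : {ffun _ -> _}) x | z in F]) #|Fv v|)).
    apply: leq_sum => u _; apply: leq_trans (vmax u).
    by rewrite -sum1_card; apply: eq_leq; apply: eq_bigl => z; rewrite inE.
  by rewrite sum_nat_const; apply: leq_mul.
move=> y; rewrite inE => /predU1P[->|ys].
  exists p, q; split => //; first by rewrite eqxx subnKC //; exact: qmin.
  (* No coordinate in the list has smaller weight than its head [x], so the agreement condition is
     vacuous here. *)
  move=> y'; rewrite inE => /predU1P[->|/minx]; first by rewrite ltnn.
  by move=> /ltnW; rewrite leqNgt => /negbTE ->.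
have [p' [q' []]] := kpq y ys.
rewrite !inE => /andP[p'F /eqP p'x] /andP[q'F /eqP q'x] p'q' h.
exists p', q'; split => //.
  by case: eqP => // yx; rewrite -yx ys in xs.
move=> y'; rewrite inE => /predU1P[-> _|/h //]; by rewrite p'x q'x.
Qed.

From mathcomp Require Import all_classical all_reals all_analysis.
Local Open Scope classical_set_scope.

(** * The grid: [[-M, M)] cut into [m.+1] intervals for each entry *)

Definition grid_step (R : realType) (M : R) m : R := 2 * M / m.+1%:R.

Definition grid_corner (R : realType) (M : R) n m
    (z : {ffun 'I_n * 'I_n -> 'I_m.+1}) : 'M[R]_n :=
  \matrix_(i, j) (- M + grid_step M m * (z (i, j))%:R).

Definition grid_cell (R : realType) (M : R) n m
    (z : {ffun 'I_n * 'I_n -> 'I_m.+1}) : set 'M[R]_n :=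
  mx_box (grid_corner M z) (grid_corner M z + const_mx (grid_step M m)).

Definition grid_cells (R : realType) (M : R) m n (E : set 'M[R]_n) :
    {set {ffun 'I_n * 'I_n -> 'I_m.+1}} :=
  [set z : {ffun 'I_n * 'I_n -> 'I_m.+1} |
    `[< exists2 A, E A & grid_cell M z A >]]%SET.

Lemma grid_step_gt0 (R : realType) (M : R) m : 0 < M -> 0 < grid_step M m.
Proof. by move=> M0; rewrite divr_gt0 // mulr_gt0. Qed.

Lemma grid_step_natr (R : realType) (M : R) m :
  grid_step M m * m.+1%:R = 2 * M.
Proof. by rewrite /grid_step mulfVK. Qed.

Lemma grid_cell_exists (R : realType) (M : R) m n (A : 'M[R]_n) :
  0 < M -> (forall i j, - M <= A i j < M) ->
  exists z : {ffun 'I_n * 'I_n -> 'I_m.+1}, grid_cell M z A.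
Proof.
move=> M0 AM; have s0 := grid_step_gt0 m M0.
(* Each index is the integer part of the rescaled entry; it is below [m.+1], so [inord] does not
   alter it. *)
exists [ffun ij => inord (Num.truncn ((A ij.1 ij.2 + M) / grid_step M m))].
move=> i j; rewrite !mxE !ffunE /=.
have /andP[AM1 AM2] := AM i j.
set x := _ / _.
have x0 : 0 <= x by rewrite divr_ge0 ?(ltW s0) // -lerBlDr sub0r.
have xm : x < m.+1%:R.
  by rewrite ltr_pdivrMr // mulrC grid_step_natr mulr_natl mulr2n ltrD2r.
have /andP[tx1 tx2] := truncn_itv x0.
have tm : (Num.truncn x < m.+1)%N by rewrite -(ltr_nat R); apply: le_lt_trans xm.
have -> : A i j = - M + grid_step M m * x.
  by rewrite /x mulrC divfK ?gt_eqF // addrC addrK.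
rewrite inordK // lerD2l ler_pM2l // tx1; split => //.
by rewrite -addrA ltrD2l -[X in _ + X]mulr1 -mulrDr ltr_pM2l // natr1.
Qed.

Lemma grid_cell_norm_le (R : realType) (M : R) m n
    (z : {ffun 'I_n * 'I_n -> 'I_m.+1}) A : 0 < M ->
  grid_cell M z A -> forall i j, `|A i j - grid_corner M z i j| <= grid_step M m.
Proof.
move=> M0 + i j => /(_ i j); rewrite [X in _ < X]mxE [X in _ < _ + X]mxE.
by move=> [h1 h2]; rewrite ger0_norm ?subr_ge0 // lerBlDl ltW.
Qed.

(** * Outer measure compared with cell counts *)

Lemma mx_box_vol_ge0 (R : realType) n (a b : 'M[R]_n) : 0 <= mx_box_vol a b.
Proof. by do 2!(apply: prodr_ge0 => ? _); rewrite le_max lexx. Qed.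

Lemma mx_box_vol_cube (R : realType) n (a : 'M[R]_n) (e : R) : 0 <= e ->
  mx_box_vol a (a + const_mx e) = e ^+ (n ^ 2).
Proof.
move=> e0; rewrite /mx_box_vol.
under eq_bigr => i _ do under eq_bigr => j _ do
  rewrite !mxE (addrC (a i j)) addrK (max_idPr e0).
by rewrite !prodr_const card_ord -exprM mulnn.
Qed.

Lemma mx_lebesgue_outer_le_cover (R : realType) n (E : set 'M[R]_n)
    (s : seq ('M[R]_n * 'M[R]_n)) (a b : nat -> 'M[R]_n) N :
  (forall A, E A -> (exists2 c, c \in s & mx_box c.1 c.2 A) \/
                    (exists2 k, (N <= k)%N & mx_box (a k) (b k) A)) ->
  (mx_lebesgue_outer E <= (\sum_(c <- s) mx_box_vol c.1 c.2)%:E +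
    \sum_(N <= k <oo) (mx_box_vol (a k) (b k))%:E)%E.
Proof.
move=> cov; apply: ereal_inf_lbound.
pose c k := if (k < size s)%N then nth (0, 0) s k
            else (a (k - size s + N)%N, b (k - size s + N)%N).
exists (fun k => (c k).1), (fun k => (c k).2); split.
  move=> A /cov [[d ds dA]|[k Nk kA]].
    exists (index d s) => //; rewrite /c index_mem ds nth_index //.
  exists (k - N + size s)%N => //.
  by rewrite /c ltnNge leq_addl /= addnK subnK.
have vol0 k : (0 <= (mx_box_vol (c k).1 (c k).2)%:E)%E.
  by rewrite lee_fin mx_box_vol_ge0.
rewrite (nneseries_split 0 (size s)) // add0n; congr (_ + _)%E.
  rewrite (big_nth (0, 0)) -sumEFin [in RHS]big_nat_cond [in LHS]big_nat_cond.
  by apply: eq_bigr => k /andP[/andP[_ ks] _]; rewrite /c ks.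
rewrite -[LHS]nneseries_addn; last by move=> k; rewrite lee_fin mx_box_vol_ge0.
rewrite -[RHS]nneseries_addn //; apply: eq_eseriesr => k _.
by rewrite /c ltnNge leq_addl /= addnK.
Qed.

(** Take a countable cover of finite total volume. Its tail costs less than [d], and the remaining
    finitely many boxes are bounded, so grid cells cover the part of [E] in them. [M0] does not
    depend on [m], which leaves the mesh free. *)
Lemma mx_lebesgue_outer_le_grid (R : realType) n (E : set 'M[R]_n) (d : R) :
  0 < d -> (mx_lebesgue_outer E < +oo)%E ->
  exists2 M0 : R, 1 <= M0 & forall M m, M0 <= M ->
    (mx_lebesgue_outer E <=
      (#|grid_cells M m E|%:R * grid_step M m ^+ (n ^ 2))%:E + d%:E)%E.
Proof.
move=> d0 /ereal_inf_lt[_ [a [b [cov ->]]] sfin].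
have vol0 k : (0 <= (mx_box_vol (a k) (b k))%:E)%E.
  by rewrite lee_fin mx_box_vol_ge0.
have [N tailN] : exists N, (\sum_(N <= k <oo) (mx_box_vol (a k) (b k))%:E < d%:E)%E.
  have tail := nneseries_tail_cvg sfin (fun k _ => vol0 k).
  have : \forall N \near \oo,
      (\sum_(N <= k <oo) (mx_box_vol (a k) (b k))%:E < d%:E)%E.
    apply: (tail [set x | (x < d%:E)%E]); apply: open_nbhs_nbhs; split; last by rewrite /= lte_fin.
    exact: open_ereal_lt_ereal.
  by move=> [N _ h]; exists N; apply: h => /=.
pose B := \sum_(k < N) \sum_i \sum_j (`|a k i j| + `|b k i j|).
have Bge k i j : (k < N)%N -> `|a k i j| + `|b k i j| <= B.
  move=> kN; rewrite /B (bigD1 (Ordinal kN)) //= (bigD1 i) //= (bigD1 j) //=.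
  rewrite -!addrA lerD2l lerDl !addr_ge0 //;
    by repeat (apply: sumr_ge0 => ? _); rewrite addr_ge0.
exists (1 + B); first by rewrite lerDl; do 3!(apply: sumr_ge0 => ? _); rewrite addr_ge0.
move=> M m BM.
have B0 : 0 <= B by do 3!(apply: sumr_ge0 => ? _); rewrite addr_ge0.
have M0 : 0 < M by apply: lt_le_trans BM; rewrite ltr_pwDl.
apply: (le_trans (mx_lebesgue_outer_le_cover (N := N) (a := a) (b := b)
  (s := [seq (grid_corner M z, grid_corner M z + const_mx (grid_step M m)) |
         z <- enum (grid_cells M m E)]) _)).
  move=> A EA; have [k _ kA] := cov A EA.
  have [kN|Nk] := ltnP k N; [left|by right; exists k].
  have [|z zA] := @grid_cell_exists _ M m _ A M0.
    move=> i j; have [aA Ab] := kA i j; have := Bge k i j kN.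
    have := ler_norm (- a k i j); have := ler_norm (b k i j).
    rewrite normrN => h1 h2 h3; apply/andP; split.
      rewrite lerNl (le_trans _ BM) // lerNl (le_trans _ aA) // lerNl.
      apply: (le_trans h2); apply: le_trans (le_trans h3 _); first by rewrite lerDl.
      by rewrite lerDr.
    apply: (lt_le_trans Ab); apply: (le_trans h1); apply: le_trans BM.
    by apply: le_trans (le_trans h3 _); rewrite ?lerDr.
  exists (grid_corner M z, grid_corner M z + const_mx (grid_step M m)) => //.
  apply: map_f; rewrite mem_enum inE; apply/asboolP; by exists A.
rewrite big_map big_enum /=; apply: leeD; last exact: ltW.
rewrite lee_fin; under eq_bigr => z _ do
  rewrite mx_box_vol_cube ?(ltW (grid_step_gt0 _ M0)) //.
by rewrite sumr_const mulr_natl.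
Qed.

(** * Cell counts bounded by the determinants *)

Lemma normr_polar_det_sub_le (R : realDomainType) n (A A' : 'I_n -> 'M[R]_n) (S : R) :
  (forall e : 'I_n -> bool, `|\det (\sum_j if e j then A j else A' j)| <= S) ->
  `|polar_det (fun j => A j - A' j)| <= 2 ^+ n * S.
Proof.
move=> detS; rewrite polar_det_altsum; apply: (le_trans (ler_norm_sum _ _ _)).
have -> : 2 ^+ n * S = \sum_(e : {ffun 'I_n -> bool}) S.
  by rewrite sumr_const card_ffun card_bool card_ord -[RHS]mulr_natl natrX.
apply: ler_sum => e _; rewrite normrM normr_prod big1 ?mul1r //.
by move=> j _; rewrite normrX normrN1 expr1n.
Qed.

Lemma grid_slicing (R : realType) n (E : set 'M[R]_n) (M : R) m :
  grid_cells M m E != finset.set0 ->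
  exists k : 'I_n * 'I_n -> nat,
    (#|grid_cells M m E| <= \prod_x (k x).+1)%N /\
    forall x, exists p q, [/\ p \in grid_cells M m E, q \in grid_cells M m E,
      p x = (q x + k x)%N :> nat &
      forall y, (mx_weight y.1 y.2 < mx_weight x.1 x.2)%N -> p y = q y].
Proof.
move=> F0; pose w (x : 'I_n * 'I_n) := mx_weight x.1 x.2.
have winj : injective w by move=> [i j] [k l] /mx_weight_inj[/= -> ->].
pose s := sort (relpre w leq) (enum {: 'I_n * 'I_n}).
have ins x : x \in s by rewrite mem_sort mem_enum.
have ws : sorted ltn (map w s).
  rewrite ltn_sorted_uniq_leq map_inj_uniq // sort_uniq enum_uniq /=.
  by rewrite -sort_map sort_sorted //; exact: leq_total.
have [z z' _ _ e|k [kF kpq]] := slicing ws F0.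
  by apply/ffunP => x; apply: e.
exists k; split.
  by apply: leq_trans kF _; rewrite (perm_big (enum {: 'I_n * 'I_n})) ?perm_sort // big_enum.
move=> x; have [p [q [pF qF pq h]]] := kpq x (ins x).
by exists p, q; split => // y; apply: h.
Qed.

(** The triangular evaluation needs entries that vanish exactly. Corner differences have them
    wherever [p] and [q] agree, while the true difference [P - Q] is only within two mesh steps of
    them. *)
Lemma grid_edge (R : realType) n (E : set 'M[R]_n) (M : R) m
    (p q : {ffun 'I_n * 'I_n -> 'I_m.+1}) : 0 < M ->
  p \in grid_cells M m E -> q \in grid_cells M m E ->
  exists P Q, let V := grid_corner M p - grid_corner M q in
    [/\ E P, E Q, forall i j, V i j = grid_step M m * ((p (i, j))%:R - (q (i, j))%:R),
        forall i j, `|V i j| <= 2 * M &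
        forall i j, `|(P - Q) i j - V i j| <= 2 * grid_step M m].
Proof.
move=> M0; rewrite !finset.inE => /asboolP[P EP cP] /asboolP[Q EQ cQ].
have VE i j : (grid_corner M p - grid_corner M q) i j =
    grid_step M m * ((p (i, j))%:R - (q (i, j))%:R).
  by rewrite !mxE opprD opprK addrACA addNr add0r mulrBr.
exists P, Q; split => // i j.
  rewrite VE normrM gtr0_norm ?grid_step_gt0 // -(grid_step_natr M m).
  rewrite ler_pM2l ?grid_step_gt0 // ler_norml.
  have lem (z : {ffun 'I_n * 'I_n -> 'I_m.+1}) : (z (i, j))%:R <= m.+1%:R :> R.
    by rewrite ler_nat ltnW.
  by rewrite lerBlDr (le_trans (lem p)) ?lerDl // andbT lerBrDl lerBlDr
    (le_trans (lem q)) // lerDr.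
have -> : (P - Q) i j - (grid_corner M p - grid_corner M q) i j =
    (P i j - grid_corner M p i j) - (Q i j - grid_corner M q i j).
  move: (grid_corner M p) (grid_corner M q) => a b.
  by rewrite !mxE !opprB addrACA [RHS]addrACA (addrC (- Q i j)).
apply: (le_trans (ler_normB _ _)).
by rewrite mulr_natl mulr2n; apply: lerD; apply: grid_cell_norm_le.
Qed.

(** The summand with factor 2 pays for replacing [P - Q] by the corner difference, at distance two
    steps; the summand 1 pays for replacing [k j] by [(k j).+1]. *)
Definition grid_error (R : realType) n (M : R) : R :=
  (#|{ffun 'I_n -> 'I_n}|%:R * #|'S_n|%:R * 2 + 1) * (n%:R * (6 * M) ^+ n).

(** Up to the grid error, the left side is the product of the leading entries of the corner
    differences [V j], then [|polar_det V|], then [|polar_det (P - Q)|], which is at most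
    [2 ^+ n.+1 * S]. *)
Lemma grid_tuple_le (R : realType) n (E : 'I_n.+1 -> set 'M[R]_n.+1) (S M : R) m
    (s t : 'I_n.+1) (k : 'I_n.+1 -> nat) : 1 <= M ->
  (forall A, (forall j, E j (A j)) -> `|\det (\sum_j A j)| <= S) ->
  (forall j, exists p q, [/\ p \in grid_cells M m (E j), q \in grid_cells M m (E j),
      p (j + s, j + t) = (q (j + s, j + t)%R + k j)%N :> nat &
      forall y, (mx_weight y.1 y.2 < mx_weight (j + s)%R (j + t)%R)%N -> p y = q y]) ->
  \prod_j (grid_step M m * (k j).+1%:R) <=
    2 ^+ n.+1 * S + grid_error n.+1 M * grid_step M m.
Proof.
move=> M1 detS pq; set e := grid_step M m.
have M0 : 0 < M by apply: lt_le_trans M1.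
have e0 : 0 < e by apply: grid_step_gt0.
have eM : e <= 2 * M.
  by rewrite -(grid_step_natr M m) ler_peMr ?(ltW e0) // ler1n.
have /choice[PQV PQVP] : forall j, exists PQV : 'M[R]_n.+1 * 'M[R]_n.+1 * 'M[R]_n.+1,
    [/\ E j PQV.1.1, E j PQV.1.2,
      (PQV.2 (j + s) (j + t) = e * (k j)%:R) /\
      forall a b, (mx_weight a b < mx_weight (j + s)%R (j + t)%R)%N -> PQV.2 a b = 0,
      forall a b, `|PQV.2 a b| <= 2 * M &
      forall a b, `|(PQV.1.1 - PQV.1.2) a b - PQV.2 a b| <= 2 * e].
  move=> j; have [p [q [pF qF pqk h]]] := pq j.
  have [P [Q [EP EQ VE VM PQV]]] := grid_edge M0 pF qF.
  exists (P, Q, grid_corner M p - grid_corner M q); split => //=; split.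
    by rewrite VE pqk natrD addrAC subrr add0r.
  by move=> a b /(h (a, b)) ab; rewrite VE ab subrr mulr0.
pose P j := (PQV j).1.1; pose Q j := (PQV j).1.2; pose V j := (PQV j).2.
(* A common bound for the entries of [V j], at most [2 * M], and of [P j - Q j], at most
   [2 * e + 2 * M] with [e <= 2 * M]. *)
pose K := 6 * M.
have MK : 2 * M <= K by rewrite ler_pM2r // ler_nat.
have K1 : 1 <= K.
  by apply: le_trans MK; apply: (le_trans M1); rewrite ler_peMl ?(ltW M0) // ler1n.
have VK j a b : `|V j a b| <= K.
  by have [_ _ _ h _] := PQVP j; apply: le_trans MK.
have UV j a b : `|(P j - Q j) a b - V j a b| <= 2 * e by have [] := PQVP j.
have UK j a b : `|(P j - Q j) a b| <= K.
  rewrite -(subrK (V j a b) ((P j - Q j) a b)).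
  apply: (le_trans (ler_normD _ _)).
  have [_ _ _ h _] := PQVP j.
  apply: (le_trans (lerD (UV j a b) (h a b))).
  apply: (@le_trans _ _ (2 * (2 * M) + 2 * M)); first by rewrite lerD2r ler_pM2l.
  by rewrite mulrA -mulrDl ler_pM2r // -natrM -natrD ler_nat.
have DU : `|polar_det (fun j => P j - Q j)| <= 2 ^+ n.+1 * S.
  apply: normr_polar_det_sub_le => c; apply: detS => j.
  by have [] := PQVP j; case: (c j).
have DV : `|polar_det V| = \prod_j (e * (k j)%:R).
  rewrite (@normr_polar_det_triangular _ _ _ s t); last first.
    by move=> j a b; have [_ _ [_ h] _ _] := PQVP j; apply: h.
  apply: eq_bigr => j _; have [_ _ [-> _] _ _] := PQVP j.
  by rewrite ger0_norm // mulr_ge0 // ltW.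
have k_le j : (k j <= m)%N.
  have [p [q [_ _ pqk _]]] := pq j.
  by rewrite -ltnS (leq_trans _ (ltn_ord (p (j + s, j + t)))) // pqk ltnS leq_addl.
have ekK (l : nat) : (l <= m.+1)%N -> `|e * l%:R| <= K.
  move=> lm; rewrite ger0_norm; last by rewrite mulr_ge0 // ltW.
  apply: le_trans MK.
  by rewrite -(grid_step_natr M m) ler_pM2l // ler_nat.
have := @dist_prod_le R n.+1 (fun j => e * (k j).+1%:R) (fun j => e * (k j)%:R) K e K1
  (fun j => ekK (k j).+1 (k_le j)) (fun j => ekK _ (leqW (k_le j))).
have step j : `|e * (k j).+1%:R - e * (k j)%:R| <= e.
  by rewrite -mulrBr -natr1 addrAC subrr add0r mulr1 gtr0_norm.
move=> /(_ step) /ler_normlW; rewrite -DV lerBlDr => h1.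
have h2 := dist_polar_det_le K1 UK VK UV (mulr_ge0 (ler0n _ _) (ltW e0)).
have h3 : `|polar_det V| <= 2 ^+ n.+1 * S +
    #|{ffun 'I_n.+1 -> 'I_n.+1}|%:R * #|'S_n.+1|%:R * (n.+1%:R * K ^+ n.+1 * (2 * e)).
  rewrite -(subKr (polar_det (fun j => P j - Q j)) (polar_det V)).
  by apply: (le_trans (ler_normB _ _)); apply: lerD.
apply: (le_trans h1); rewrite addrC; apply: (le_trans (lerD h3 (lexx _))).
have alg (c L x : R) : c * (L * (2 * x)) + L * x = (c * 2 + 1) * L * x.
  by rewrite (mulrDl _ 1 L) mul1r (mulrDl _ L x) !mulrA (mulrAC c L 2).
by rewrite -addrA lerD2l alg.
Qed.

Lemma prod_grid_volume_le (R : realType) n (E : 'I_n.+1 -> set 'M[R]_n.+1) (S M : R) m :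
  1 <= M -> (forall A, (forall j, E j (A j)) -> `|\det (\sum_j A j)| <= S) ->
  (forall j, grid_cells M m (E j) != finset.set0) ->
  \prod_j (#|grid_cells M m (E j)|%:R * grid_step M m ^+ (n.+1 ^ 2)) <=
    (2 ^+ n.+1 * S + grid_error n.+1 M * grid_step M m) ^+ (n.+1 ^ 2).
Proof.
move=> M1 detS F0; set e := grid_step M m.
have e0 : 0 <= e by apply/ltW/grid_step_gt0/(lt_le_trans _ M1).
have /choice[k kP] j := grid_slicing (F0 j).
have cardI : #|{: 'I_n.+1 * 'I_n.+1}| = (n.+1 ^ 2)%N by rewrite card_prod card_ord.
apply: (@le_trans _ _ (\prod_j \prod_x (e * (k j x).+1%:R))).
  apply: ler_prod => j _; rewrite mulr_ge0 ?exprn_ge0 //=.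
  rewrite big_split /= prodr_const cardI mulrC ler_wpM2l ?exprn_ge0 //.
  by rewrite -natr_prod ler_nat; have [] := kP j.
(* For fixed [j], the cyclic shift by [(j, j)] permutes the positions, so the product regroups into
   one placement for each shift [x = (s, t)]. *)
have -> : \prod_j \prod_x (e * (k j x).+1%:R) =
    \prod_(x : 'I_n.+1 * 'I_n.+1) \prod_j (e * (k j (j + x.1, j + x.2)).+1%:R).
  rewrite [RHS]exchange_big /=; apply: eq_bigr => j _.
  apply: (reindex_inj (h := fun x : 'I_n.+1 * 'I_n.+1 => (j + x.1, j + x.2))).
  move=> [a b] [c d] h.
  by have /addrI /= -> := congr1 fst h; have /addrI /= -> := congr1 snd h.
rewrite -cardI -prodr_const; apply: ler_prod => -[s t] _.
rewrite prodr_ge0 /=; last by move=> j _; rewrite mulr_ge0.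
by apply: (@grid_tuple_le _ _ E S M m s t) => // j; have [_] := kP j; apply.
Qed.

(** * Passage to measures and conclusion *)

Lemma powR_prod_ge0 (R : realType) (I : finType) (F : I -> R) (r : R) :
  (forall i, 0 <= F i) -> \prod_i F i `^ r = (\prod_i F i) `^ r.
Proof.
move=> F0; suff [] : \prod_i F i `^ r = (\prod_i F i) `^ r /\ 0 <= \prod_i F i by [].
elim/big_rec2: _ => [|i y z _ [-> z0]]; first by rewrite powR1 ler01.
by rewrite powRM // mulr_ge0.
Qed.

(** Allowing [d] to be half of each measure loses a factor 2 per set; together with the [2 ^+ n.+1]
    of the alternating sum this gives [4 ^+ n.+1]. *)
Lemma prod_outer_powR_le (R : realType) n (E : 'I_n.+1 -> set 'M[R]_n.+1) (S : R) :
  (forall j, mx_lebesgue_outer (E j) < +oo)%E ->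
  (forall j, 0 < fine (mx_lebesgue_outer (E j))) -> 0 <= S ->
  (forall A, (forall j, E j (A j)) -> `|\det (\sum_j A j)| <= S) ->
  \prod_j fine (mx_lebesgue_outer (E j)) `^ ((n.+1 ^ 2)%:R)^-1 <= 4 ^+ n.+1 * S.
Proof.
move=> Efin E0 S0 detS; pose v j := fine (mx_lebesgue_outer (E j)).
have half0 j : 0 < v j / 2 by rewrite divr_gt0 ?E0.
have EE j : mx_lebesgue_outer (E j) = (v j)%:E.
  by rewrite /v; move: (E0 j); case: mx_lebesgue_outer; rewrite //= ltxx.
have /choice[M MP] : forall j, exists M0 : R, 1 <= M0 /\ forall M m, M0 <= M ->
    v j / 2 <= #|grid_cells M m (E j)|%:R * grid_step M m ^+ (n.+1 ^ 2).
  move=> j; have [M0 M01 h] := mx_lebesgue_outer_le_grid (half0 j) (Efin j).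
  exists M0; split => // M m MM0.
  have := h M m MM0; rewrite EE -EFinD lee_fin {1}(splitr (v j)) lerD2r.
  by [].
(* One cube must serve all the sets; the sum dominates each [M j] because all of them are at least
   1. *)
pose K := \sum_j M j.
have MK j : M j <= K.
  rewrite /K (bigD1 j) //= lerDl sumr_ge0 // => i _.
  by have [h _] := MP i; apply: le_trans h.
have K1 : 1 <= K by have [h _] := MP ord0; apply: le_trans (MK ord0).
have ge0 : 0 <= grid_error n.+1 K.
  by rewrite /grid_error mulr_ge0 ?addr_ge0 ?mulr_ge0 ?exprn_ge0 ?mulr_ge0 // (le_trans _ K1).
apply/ler_addgt0Pr => eta eta0.
(* The mesh is chosen after [K], fine enough that the grid error contributes at most [eta]. *)
pose m := Num.truncn (2 ^+ n.+1 * grid_error n.+1 K * (2 * K) / eta).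
have step_le : 2 ^+ n.+1 * (grid_error n.+1 K * grid_step K m) <= eta.
  rewrite mulrA /grid_step mulrA ler_pdivrMr // (mulrC eta) -ler_pdivrMr //.
  by apply/ltW; apply: truncnS_gt.
set X := 2 ^+ n.+1 * S + grid_error n.+1 K * grid_step K m.
have st0 : 0 < grid_step K m by apply/grid_step_gt0/(lt_le_trans _ K1).
have X0 : 0 <= X by apply: addr_ge0; apply: mulr_ge0; rewrite ?exprn_ge0 // ltW.
apply: (@le_trans _ _ (2 ^+ n.+1 * X)); last first.
  by rewrite /X mulrDr mulrA -exprMn -natrM lerD2l.
have vol j : v j / 2 <= #|grid_cells K m (E j)|%:R * grid_step K m ^+ (n.+1 ^ 2).
  by have [_] := MP j; apply.
have F0 j : grid_cells K m (E j) != finset.set0.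
  rewrite -finset.card_gt0 lt0n; apply: contraTneq (vol j) => ->.
  by rewrite mul0r -ltNge.
have := prod_grid_volume_le K1 detS F0; rewrite -/X => h.
have prodv : \prod_j v j <= (2 ^+ n.+1 * X) ^+ (n.+1 ^ 2).
  (* The halving factor is crudely raised to the power [n.+1 ^ 2], so that the whole bound is a
     perfect power and its root is [2 ^+ n.+1 * X]. *)
  apply: (@le_trans _ _ (2 ^+ n.+1 * X ^+ (n.+1 ^ 2))); last first.
    rewrite exprMn ler_wpM2r ?exprn_ge0 // -[leLHS]expr1 ler_weXn2l //.
    by rewrite exprn_ege1 // ler1n.
  apply: le_trans (ler_wpM2l (exprn_ge0 _ (ler0n _ _)) h).
  rewrite -[X in 2 ^+ X]card_ord -prodr_const -big_split /=.
  apply: ler_prod => j _; rewrite ltW ?E0 //=.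
  by rewrite mulrC -ler_pdivrMr.
rewrite powR_prod_ge0; last by move=> j; rewrite ltW ?E0.
have Y0 : 0 <= 2 ^+ n.+1 * X by rewrite mulr_ge0 ?exprn_ge0.
set Y := 2 ^+ n.+1 * X in prodv Y0 *.
have -> : Y = (Y ^+ (n.+1 ^ 2)) `^ ((n.+1 ^ 2)%:R)^-1.
  by rewrite -powR_mulrn // -powRrM mulfV ?pnatr_eq0 ?expn_eq0 // powRr1.
apply: ge0_ler_powR; rewrite ?nnegrE ?invr_ge0 ?exprn_ge0 //.
by apply: prodr_ge0 => j _; rewrite ltW ?E0.
Qed.

Lemma mx_lebesgue_outer_ge0 (R : realType) n (E : set 'M[R]_n) :
  (0 <= mx_lebesgue_outer E)%E.
Proof.
apply: le_ereal_inf_tmp => _ [a [b [_ ->]]].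
by apply: nneseries_ge0 => k _ _; rewrite lee_fin mx_box_vol_ge0.
Qed.

Theorem mainTheorem1 (R : realType) (n : nat) (hn : (1 <= n)%N) :
  exists C : R,
    forall E : 'I_n -> set 'M[R]_n,
      (forall j, mx_lebesgue_measurable (E j)) ->
      (forall j, (mx_lebesgue_outer (E j) < +oo)%E) ->
      ((\prod_(j < n) (fine (mx_lebesgue_outer (E j)) `^ ((n ^ 2)%:R)^-1))%:E
        <= C%:E * sup_det_sum E)%E.
Proof.
case: n hn => // n _; exists (4 ^+ n.+1) => E _ Efin.
have C0 : 0 < 4 ^+ n.+1 :> R by rewrite exprn_gt0.
have sup_ub A : (forall j, E j (A j)) ->
    ((`|\det (\sum_j A j)|)%:E <= sup_det_sum E)%E.
  by move=> EA; apply: ereal_sup_ubound; right; exists A.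
have sup0 : (0 <= sup_det_sum E)%E by apply: ereal_sup_ubound; left.
have [E0|/existsNP[j /negP]] := pselect (forall j, 0 < fine (mx_lebesgue_outer (E j))).
  case supE : (sup_det_sum E) sup0 sup_ub => [S| |] // S0 detS.
    by rewrite -EFinM lee_fin; apply: prod_outer_powR_le.
  (* An infinite supremum makes the right side infinite, since the constant is positive. *)
  by rewrite gt0_muley ?leey // lte_fin.
rewrite -leNgt => Ej0.
have {}Ej0 : fine (mx_lebesgue_outer (E j)) = 0.
  by apply/eqP; rewrite eq_le Ej0 fine_ge0 // mx_lebesgue_outer_ge0.
(* A null set annihilates the product; the exponent must be nonzero here, as zero to the power zero
   is 1. *)
rewrite (bigD1 j) //= Ej0 powR0 ?invr_neq0 ?pnatr_eq0 ?expn_eq0 // mul0r.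
by rewrite mule_ge0 // lee_fin ltW.
Qed.
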